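(* The function $\xi \colon \mathbb{N}\setminus\{0\} \to \mathbb{N}\setminus\{0\}$ is computable in the limit.
   Context: $\mathbb{N}$ denotes the non-negative integers. For a positive integer $n$, let $B_n=\{x_i \cdot x_j=x_k,\ x_i+1=x_k : i,j,k \in \{1,\ldots,n\}\}$, a finite set of equations in the variables $x_1,\ldots,x_n$ (the indices need not be distinct). For a positive integer $n$, $\xi(n)$ denotes the smallest positive integer $b$ such that for each system $\mathcal{S} \subseteq B_n$ with a unique solution in positive integers $x_1,\ldots,x_n$, this solution belongs to $[1,b]^n$. A function $h \colon \mathbb{N}\setminus\{0\} \to \mathbb{N}\setminus\{0\}$ is computable in the limit if there is a computable function $\varphi(n,k)$ of two positive integer arguments such that for every $n$ one has $\varphi(n,k)=h(n)$ for all sufficiently large $k$. *)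

(* Defs.v *)
(* Mathematical Components, with classical reasoning from mathcomp.classical. *)
From mathcomp Require Import all_boot.
From mathcomp Require Import boolp.

Set Implicit Arguments.
Unset Strict Implicit.
Unset Printing Implicit Defensive.

Definition posnat := {m : nat | 0 < m}.

Definition nat_of_posnat (m : posnat) : nat := val m.
Coercion nat_of_posnat : posnat >-> nat.

(* The set B_n: [inl (i, j, k)] is the equation x_i * x_j = x_k and
   [inr (i, k)] is x_i + 1 = x_k, with indices running over 0, .., n-1. *)
Definition B (n : nat) := ('I_n * 'I_n * 'I_n + 'I_n * 'I_n)%type.

Definition satisfies n (x : {ffun 'I_n -> posnat}) (e : B n) : Prop :=
  match e with
  | inl (i, j, k) => x i * x j = x k
  | inr (i, k) => x i + 1 = x k
  end.

Definition solution n (S : {set B n}) (x : {ffun 'I_n -> posnat}) : Prop :=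
  forall e, e \in S -> satisfies x e.

Definition bounds_unique_solutions (n b : nat) : Prop :=
  forall (S : {set B n}) (x : {ffun 'I_n -> posnat}),
    unique (solution S) x -> forall i, x i <= b.

Lemma xi_exists (n : nat) :
  exists b, (0 < b) && `[< bounds_unique_solutions n b >].
Proof.
pose bnd (S : {set B n}) b := forall x : {ffun 'I_n -> posnat},
  unique (solution S) x -> forall i, x i <= b.
have bnd_ex S : exists b, bnd S b.
  case: (pselect (exists x, unique (solution S) x)) => [[x ux]|nux]; last first.
    by exists 0 => x ux; case: nux; exists x.
  exists (\max_i (x i : nat)) => y [sy _] i; have <- : x = y by apply: ux.2.
  exact: (leq_bigmax (F := fun i => x i : nat)).
have [f fP] := choice bnd_ex.
exists (\max_S f S).+1; apply/asboolP => S x ux i.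
by apply/leqW/(leq_trans (fP S x ux i)); apply: leq_bigmax.
Qed.

Definition xi_nat (n : nat) : nat := ex_minn (xi_exists n).

Lemma xi_nat_gt0 n : 0 < xi_nat n.
Proof. by rewrite /xi_nat; case: ex_minnP => m /andP[]. Qed.

Definition xi (n : posnat) : posnat := exist _ (xi_nat n) (xi_nat_gt0 n).

Lemma xiP (n : posnat) :
  bounds_unique_solutions n (xi n) /\
  forall b, 0 < b -> bounds_unique_solutions n b -> xi n <= b.
Proof.
rewrite /nat_of_posnat /= /xi_nat; case: ex_minnP => m /andP[_ /asboolP mP] mmin.
by split=> // b b0 bP; apply: mmin; rewrite b0; apply/asboolP.
Qed.

(* Codes of k-ary partial recursive (Kleene) functions. The inner functions of
   a composition are indexed by the finite type 'I_m, so a code is a finite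
   object. *)
Inductive recfun : nat -> Type :=
| rzero : recfun 0
| rsucc : recfun 1
| rproj k : 'I_k -> recfun k
| rcomp m k : recfun m -> ('I_m -> recfun k) -> recfun k
| rprec k : recfun k -> recfun k.+2 -> recfun k.+1
| rmu k : recfun k.+1 -> recfun k.

(* [computes p v y]: the computation of [p] on the arguments [v] halts with
   value [y]. In primitive recursion the first argument is the recursion
   variable, and the step function receives the current index, the previous
   value and the parameters; [c] lists the successive values. Minimization
   searches for the least first argument where the function vanishes, all
   earlier values being required to be defined. *)
Fixpoint computes k (p : recfun k) : k.-tuple nat -> nat -> Prop :=
  match p in recfun k return k.-tuple nat -> nat -> Prop with
  | rzero => fun _ y => y = 0
  | rsucc => fun v y => y = (thead v).+1
  | rproj _ i => fun v y => y = tnth v i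
  | rcomp m _ g f => fun v y =>
      exists2 w : m.-tuple nat,
        forall i, computes (f i) v (tnth w i) & computes g w y
  | rprec _ f g => fun v y =>
      exists c : nat -> nat,
        [/\ computes f [tuple of behead v] (c 0),
            forall i, i < thead v ->
              computes g [tuple of i :: c i :: behead v] (c i.+1)
          & y = c (thead v)]
  | rmu _ f => fun v y =>
      computes f [tuple of y :: v] 0 /\
      forall i, i < y -> exists z, computes f [tuple of i :: v] z.+1
  end.

Definition computable2 (phi : posnat -> posnat -> nat) : Prop :=
  exists p : recfun 2,
    forall n k : posnat, computes p [tuple (n : nat); (k : nat)] (phi n k).

Definition computable_in_the_limit (h : posnat -> posnat) : Prop :=
  exists phi : posnat -> posnat -> nat,
    computable2 phi /\
    forall n : posnat, exists k0 : posnat, forall k : posnat,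
      k0 <= k -> phi n k = h n.

(* Main.v *)
Require Import Defs.
From mathcomp Require Import all_boot.
From mathcomp Require Import boolp.

Set Implicit Arguments.
Unset Strict Implicit.
Unset Printing Implicit Defensive.

(** At stage [k], search for unique solutions inside the box [1, k]^n only: let
    [approx n k] be the largest entry of a tuple of the box which is the only
    tuple of the box satisfying some system over [n] variables (or 1).

    This is a bounded search, hence recursive ([recursive_approx]): tuples are
    coded by their base-[k] digits, and the class of recursive functions is
    closed under arithmetic, bounded quantifiers and bounded maxima.

    For fixed [n] the approximation is eventually equal to [xi n]
    ([approx_cvg]). It can be wrong in two ways. A unique solution may not yet
    lie in the box; this stops at [k = xi n], by definition of [xi]. Or a system
    may have several solutions but only one in the box; there are finitely many
    systems, and for each of them this stops once two of its solutions are in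
    the box ([uniqueness_stabilizes]). *)

(** * Closure properties of total recursive functions *)

(** A function of [k] arguments is written as a function of an infinite
    environment read only at positions below [k] (and 0 beyond). Binding a new
    first variable then amounts to the index shift [fun i => e i.+1], which
    beta-reduces on variables, so that the recursiveness of a formula can be
    proved by following its syntax. *)
Definition recursive k (F : (nat -> nat) -> nat) : Prop :=
  exists p : recfun k, forall v : k.-tuple nat, computes p v (F (nth 0 v)).

Lemma eq_recursive k F G : F =1 G -> recursive k F -> recursive k G.
Proof. by move=> eqFG [p pP]; exists p => v; rewrite -eqFG. Qed.

Lemma recursive_var k i : i < k -> recursive k (fun e => e i).
Proof.
by move=> ltik; exists (rproj (Ordinal ltik)) => v; rewrite /= (tnth_nth 0).
Qed.

Lemma recursive0 k : recursive k (fun=> 0).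
Proof.
(* The least y with y = 0; unlike [rzero], this works at every arity. *)
by exists (rmu (rproj ord0)) => v; split.
Qed.

Lemma recursiveS k F : recursive k F -> recursive k (fun e => (F e).+1).
Proof.
move=> [p pP]; exists (rcomp rsucc (fun=> p)) => v /=.
exists [tuple F (nth 0 v)]; last by [].
by move=> i; rewrite ord1.
Qed.

Lemma recursive_const k c : recursive k (fun=> c).
Proof. by elim: c => [|c]; [apply: recursive0 | apply: recursiveS]. Qed.

(** Lets an outer expression be used under a binder. *)
Lemma recursive_shift k F :
  recursive k F -> recursive k.+1 (fun e => F (fun i => e i.+1)).
Proof.
move=> [p pP]; exists (rcomp p (fun i : 'I_k => rproj (lift ord0 i))) => v /=.
exists [tuple of behead v] => [i|].
  by rewrite !(tnth_nth 0) /= nth_behead.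
suff -> : (fun i => nth 0 v i.+1) = nth 0 [tuple of behead v] by [].
by apply: funext => i; rewrite nth_behead.
Qed.

(** Primitive recursion precomposed with the bound [N] and all the parameters.
    Every arithmetic operation below is obtained from this single scheme. *)
Lemma recursive_iteri k N A (G : nat -> nat -> (nat -> nat) -> nat) :
    recursive k N -> recursive k A ->
    recursive k.+2 (fun e => G (e 0) (e 1) (fun i => e i.+2)) ->
  recursive k (fun e => iteri (N e) (fun i a => G i a e) (A e)).
Proof.
move=> [p pP] [a aP] [g gP].
(* The recursion variable is computed by [p]; the parameters are passed on. *)
exists (rcomp (rprec a g)
  (fun i => if unlift ord0 i is Some j then rproj j else p)) => v /=.
have vE : [tuple of behead (N (nth 0 v) :: v)] = v by apply: val_inj.
exists [tuple of N (nth 0 v) :: v] => [i|].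
  by case: unliftP => [j ->|->] //=; rewrite !(tnth_nth 0).
exists (fun i => iteri i (fun j b => G j b (nth 0 v)) (A (nth 0 v))).
split=> [|i _|].
- by have := aP v; rewrite -[X in computes _ X]vE.
- set c := iteri i _ _.
  exact: (gP [tuple of i :: c :: behead [tuple of N (nth 0 v) :: v]]).
- by rewrite theadE.
Qed.

Lemma recursiveD k F G :
  recursive k F -> recursive k G -> recursive k (fun e => F e + G e).
Proof.
move=> rF rG.
apply: (@eq_recursive _ (fun e => iteri (G e) (fun _ a => a.+1) (F e))).
  by move=> e; elim: (G e) => [|n /= ->]; rewrite ?addn0 ?addnS.
by apply: recursive_iteri => //; apply/recursiveS/recursive_var.
Qed.

Lemma recursive_pred k F : recursive k F -> recursive k (fun e => (F e).-1).
Proof.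
move=> rF; apply: (@eq_recursive _ (fun e => iteri (F e) (fun i _ => i) 0)).
  by move=> e; case: (F e).
by apply: recursive_iteri => //; [apply: recursive0 | apply: recursive_var].
Qed.

Lemma recursiveB k F G :
  recursive k F -> recursive k G -> recursive k (fun e => F e - G e).
Proof.
move=> rF rG.
apply: (@eq_recursive _ (fun e => iteri (G e) (fun _ a => a.-1) (F e))).
  by move=> e; elim: (G e) => [|n /= ->]; rewrite ?subn0 ?subnS.
by apply: recursive_iteri => //; apply/recursive_pred/recursive_var.
Qed.

Lemma recursiveM k F G :
  recursive k F -> recursive k G -> recursive k (fun e => F e * G e).
Proof.
move=> rF rG.
apply: (@eq_recursive _ (fun e => iteri (G e) (fun _ a => F e + a) 0)).
  by move=> e; elim: (G e) => [|n /= ->]; rewrite ?muln0 ?mulnS.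
apply: recursive_iteri => //; first exact: recursive0.
apply: recursiveD; last exact: recursive_var.
exact: (recursive_shift (recursive_shift rF)).
Qed.

Lemma recursiveX k F G :
  recursive k F -> recursive k G -> recursive k (fun e => F e ^ G e).
Proof.
move=> rF rG.
apply: (@eq_recursive _ (fun e => iteri (G e) (fun _ a => F e * a) 1)).
  by move=> e; elim: (G e) => [|n /= ->]; rewrite ?expn0 ?expnS.
apply: recursive_iteri => //; first exact: recursive_const.
apply: recursiveM; last exact: recursive_var.
exact: (recursive_shift (recursive_shift rF)).
Qed.

Lemma recursive_if k (b : (nat -> nat) -> bool) F G :
    recursive k b -> recursive k F -> recursive k G ->
  recursive k (fun e => if b e then F e else G e).
Proof.
move=> rb rF rG.
apply: (@eq_recursive _ (fun e => iteri (b e) (fun _ _ => F e) (G e))).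
  by move=> e; case: (b e).
by apply: recursive_iteri => //; exact: (recursive_shift (recursive_shift rF)).
Qed.

Lemma recursive_leq k F G :
  recursive k F -> recursive k G -> recursive k (fun e => F e <= G e).
Proof.
move=> rF rG.
apply: (@eq_recursive _ (fun e => iteri (F e - G e) (fun _ _ => 0) 1)).
  by move=> e; rewrite /leq; case: (F e - G e).
apply: recursive_iteri; first exact: recursiveB.
  exact: recursive_const.
exact: recursive0.
Qed.

Lemma recursive_and k (b c : (nat -> nat) -> bool) :
  recursive k b -> recursive k c -> recursive k (fun e => b e && c e).
Proof.
move=> rb rc.
apply: (@eq_recursive _ (fun e => if b e then nat_of_bool (c e) else 0)).
  by move=> e; case: (b e).
by apply: recursive_if => //; apply: recursive0.
Qed.

Lemma recursive_imply k (b c : (nat -> nat) -> bool) :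
  recursive k b -> recursive k c -> recursive k (fun e => b e ==> c e).
Proof.
move=> rb rc.
apply: (@eq_recursive _ (fun e => if b e then nat_of_bool (c e) else 1)).
  by move=> e; case: (b e).
by apply: recursive_if => //; apply: recursive_const.
Qed.

Lemma recursive_eq k F G :
  recursive k F -> recursive k G -> recursive k (fun e => F e == G e).
Proof.
move=> rF rG.
apply: (@eq_recursive _ (fun e => (F e <= G e) && (G e <= F e))).
  by move=> e; rewrite -eqn_leq.
by apply: recursive_and; apply: recursive_leq.
Qed.

(** When [m] increases by one, its remainder increases by one or wraps around to
    0 on reaching the divisor; the divisor 0 is never reached, in accordance
    with [m %% 0 = m]. *)
Lemma recursive_modn k F G :
  recursive k F -> recursive k G -> recursive k (fun e => F e %% G e).
Proof.
move=> rF rG.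
apply: (@eq_recursive _ (fun e =>
    iteri (F e) (fun _ r => if r.+1 == G e then 0 else r.+1) 0)).
  move=> e; elim: (F e) => [|m /= ->]; first by rewrite mod0n.
  rewrite modnS; congr (if _ then _ else _).
  have [->|d_gt0] := posnP (G e); first by rewrite dvd0n.
  rewrite /dvdn -(addn1 m) -modnDml addn1.
  have := ltn_pmod m d_gt0; rewrite leq_eqVlt => /predU1P[->|lt].
    by rewrite eqxx modnn.
  by rewrite (modn_small lt) (ltn_eqF lt).
apply: recursive_iteri => //; first exact: recursive0.
have rS : recursive k.+2 (fun e => (e 1).+1) by apply/recursiveS/recursive_var.
apply: recursive_if => //; last exact: recursive0.
by apply: recursive_eq => //; exact: (recursive_shift (recursive_shift rG)).
Qed.

(** The quotient of [m] by [d] counts the multiples of [d] among [1, .., m]. *)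
Lemma recursive_divn k F G :
  recursive k F -> recursive k G -> recursive k (fun e => F e %/ G e).
Proof.
move=> rF rG.
apply: (@eq_recursive _ (fun e =>
    iteri (F e) (fun i q => (i.+1 %% G e == 0) + q) 0)).
  move=> e; elim: (F e) => [|m /= ->]; first by rewrite div0n.
  have [->|d_gt0] := posnP (G e); first by rewrite modn0 divn0.
  by rewrite divnS.
apply: recursive_iteri => //; first exact: recursive0.
apply: recursiveD; last exact: recursive_var.
apply: recursive_eq; last exact: recursive0.
apply: recursive_modn; first by apply/recursiveS/recursive_var.
exact: (recursive_shift (recursive_shift rG)).
Qed.

(** The body of a bounded quantifier sees the index and the outer variables,
    whereas the step of a recursion also sees the accumulator, in position 1. *)
Lemma recursive_shift_acc k (F : nat -> (nat -> nat) -> nat) :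
  recursive k.+1 (fun e => F (e 0) (fun i => e i.+1)) ->
  recursive k.+2 (fun e => F (e 0) (fun i => e i.+2)).
Proof.
move=> [p pP].
exists (rcomp p (fun i : 'I_k.+1 =>
  if unlift ord0 i is Some j then rproj (lift ord0 (lift ord0 j))
  else rproj ord0)) => v /=.
case/tupleP: v => x v; case/tupleP: v => a v.
exists [tuple of x :: v]; last exact: pP.
by move=> i; case: unliftP => [j ->|->] /=; rewrite !(tnth_nth 0).
Qed.

Lemma recursive_all k N (P : nat -> (nat -> nat) -> bool) :
    recursive k N -> recursive k.+1 (fun e => P (e 0) (fun i => e i.+1)) ->
  recursive k (fun e => all (fun i => P i e) (iota 0 (N e))).
Proof.
move=> rN rP.
apply: (@eq_recursive _ (fun e =>
    iteri (N e) (fun i a => if P i e then a else 0) 1)).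
  move=> e; elim: (N e) => // n IHn; rewrite [LHS]/= IHn -[in RHS]addn1.
  by rewrite iotaD all_cat /= andbT andbC; case: (P n e).
apply: recursive_iteri => //; first exact: recursive_const.
apply: recursive_if; last exact: recursive0.
  exact: (recursive_shift_acc (F := fun i e => nat_of_bool (P i e))).
exact: recursive_var.
Qed.

Lemma recursive_max k F G :
  recursive k F -> recursive k G -> recursive k (fun e => maxn (F e) (G e)).
Proof.
move=> rF rG; apply: recursive_if => //.
by apply: recursive_leq => //; apply: recursiveS.
Qed.

Lemma recursive_bigmax k N (F : nat -> (nat -> nat) -> nat) :
    recursive k N -> recursive k.+1 (fun e => F (e 0) (fun i => e i.+1)) ->
  recursive k (fun e => \max_(0 <= i < N e) F i e).
Proof.
move=> rN rF.
apply: (@eq_recursive _ (fun e =>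
    iteri (N e) (fun i a => maxn a (F i e)) 0)).
  move=> e; elim: (N e) => [|n /= ->]; first by rewrite big_geq.
  by rewrite big_nat_recr.
apply: recursive_iteri => //; first exact: recursive0.
by apply: recursive_max; [apply: recursive_var | apply: recursive_shift_acc].
Qed.

(** * The approximating function *)

(** Tuples in [1, b]^n are coded by the numbers below [b ^ n]: the entries are
    the base-[b] digits, shifted by one to be positive. *)
Definition entry b X i := (X %/ b ^ i %% b).+1.

Definition preserves_equations n b X Y : bool :=
  let x := entry b X in let y := entry b Y in
  all (fun i => all (fun k =>
      ((x i + 1 == x k) ==> (y i + 1 == y k)) &&
      all (fun j => (x i * x j == x k) ==> (y i * y j == y k)) (iota 0 n))
    (iota 0 n)) (iota 0 n).

(** The tuple coded by [X] is the only one in [1, b]^n that satisfies all the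
    equations holding at it. Testing this largest system instead of every
    system avoids coding the subsets of [B n]. *)
Definition isolated n b X : bool :=
  all (fun Y => preserves_equations n b X Y ==>
        all (fun i => entry b X i == entry b Y i) (iota 0 n))
      (iota 0 (b ^ n)).

(** The maximum with 1 is there because [xi n] is the least among the positive
    bounds only: the approximation has to be such a candidate bound. *)
Definition approx n b : nat :=
  maxn 1 (\max_(0 <= X < b ^ n)
    if isolated n b X then \max_(0 <= i < n) entry b X i else 0).

Lemma recursive_entry k B X I :
    recursive k B -> recursive k X -> recursive k I ->
  recursive k (fun e => entry (B e) (X e) (I e)).
Proof.
move=> rB rX rI; apply: recursiveS; apply: recursive_modn => //.
by apply: recursive_divn => //; apply: recursiveX.
Qed.

Lemma recursive_approx : recursive 2 (fun e => approx (e 0) (e 1)).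
Proof.
rewrite /approx /isolated /preserves_equations.
(* Structural descent on the formula; the last pattern catches the bodies that
   do not mention the environment. *)
repeat match goal with
 | |- recursive _ (fun e => e ?i) => apply: recursive_var => //
 | |- recursive _ (fun e => maxn _ _) => apply: recursive_max
 | |- recursive _ (fun e => \max_(0 <= i < _) _) => apply: recursive_bigmax => /=
 | |- recursive _ (fun e => nat_of_bool (all _ _)) => apply: recursive_all => /=
 | |- recursive _ (fun e => nat_of_bool (_ ==> _)) => apply: recursive_imply
 | |- recursive _ (fun e => nat_of_bool (_ && _)) => apply: recursive_and
 | |- recursive _ (fun e => nat_of_bool (_ == _)) => apply: recursive_eq
 | |- recursive _ (fun e => if _ then _ else _) => apply: recursive_if
 | |- recursive _ (fun e => _ ^ _) => apply: recursiveX
 | |- recursive _ (fun e => _ * _) => apply: recursiveM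
 | |- recursive _ (fun e => _ + _) => apply: recursiveD
 | |- recursive _ (fun e => entry _ _ _) => apply: recursive_entry
 | |- recursive _ (fun e => ?c) => exact: recursive_const
end.
Qed.

(** * Codes and tuples *)

Section Codes.
Variables n b : nat.

Definition decode X : {ffun 'I_n -> posnat} :=
  [ffun i : 'I_n => exist _ (entry b X i) (ltn0Sn _)].

Lemma decodeE X (i : 'I_n) : decode X i = entry b X i :> nat.
Proof. by rewrite ffunE. Qed.

Lemma eq_posnat_ffun (x y : {ffun 'I_n -> posnat}) :
  (forall i, x i = y i :> nat) -> x = y.
Proof. by move=> xy; apply/ffunP => i; apply/val_inj/xy. Qed.

Definition equations (x : {ffun 'I_n -> posnat}) : {set B n} :=
  [set e | `[< satisfies x e >]].

Lemma preserves_equationsP X Y :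
  reflect (solution (equations (decode X)) (decode Y))
          (preserves_equations n b X Y).
Proof.
have ord_iota (i : 'I_n) : (i : nat) \in iota 0 n by rewrite mem_iota ltn_ord.
apply: (iffP idP) => [XY e|XY].
  rewrite inE => /asboolP; case: e => [[[i j] k]|[i k]] /=; rewrite !decodeE => xe;
    have /andP[XY1 /allP XY2] := allP (allP XY i (ord_iota i)) k (ord_iota k).
    by apply/eqP/(implyP (XY2 j (ord_iota j)))/eqP.
  by apply/eqP/(implyP XY1)/eqP.
apply/allP => i; rewrite mem_iota => /= lti; apply/allP => k.
rewrite mem_iota => /= ltk; apply/andP; split.
  apply/implyP => /eqP xe.
  have := XY (inr (Ordinal lti, Ordinal ltk)).
  by rewrite inE /= !decodeE => h; apply/eqP/h/asboolP.
apply/allP => j; rewrite mem_iota => /= ltj; apply/implyP => /eqP xe.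
have := XY (inl (Ordinal lti, Ordinal ltj, Ordinal ltk)).
by rewrite inE /= !decodeE => h; apply/eqP/h/asboolP.
Qed.

Lemma isolatedP X :
  reflect (forall Y, Y < b ^ n -> solution (equations (decode X)) (decode Y) ->
             decode X = decode Y)
          (isolated n b X).
Proof.
apply: (iffP allP) => [iX Y ltY /preserves_equationsP XY|iX Y].
  have := iX Y; rewrite mem_iota XY => /(_ ltY)/allP XYi.
  apply: eq_posnat_ffun => i; rewrite !decodeE; apply/eqP/XYi.
  by rewrite mem_iota ltn_ord.
rewrite mem_iota => /= ltY; apply/implyP => /preserves_equationsP XY.
apply/allP => i; rewrite mem_iota => /= lti.
have /ffunP/(_ (Ordinal lti))/(congr1 val) := iX Y ltY XY.
by rewrite !ffunE /= => ->.
Qed.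

End Codes.

Lemma digits_surj n b (d : nat -> nat) : (forall i, i < n -> d i < b) ->
  exists2 X, X < b ^ n & forall i, i < n -> X %/ b ^ i %% b = d i.
Proof.
elim: n d => [|n IHn] d ltd; first by exists 0.
have [//|X ltX Xd] := IHn (fun i => d i.+1); first by move=> i; apply: (ltd i.+1).
have ltd0 := ltd 0 (ltn0Sn n); have b_gt0 : 0 < b by apply: leq_ltn_trans ltd0.
exists (X * b + d 0) => [|[|i] lti].
- rewrite expnSr; apply: (@leq_trans (X.+1 * b)); last by rewrite leq_pmul2r.
  by rewrite mulSn addnC ltn_add2r.
- by rewrite divn1 modnMDl modn_small.
- by rewrite expnS divnMA divnMDl // (divn_small ltd0) addn0 Xd.
Qed.

Lemma code_surj n b (x : {ffun 'I_n -> posnat}) :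
  (forall i, x i <= b) -> exists2 X, X < b ^ n & decode n b X = x.
Proof.
move=> xb; pose d i := if insub i is Some j then (x j : nat).-1 else 0.
have dE (i : 'I_n) : (d i).+1 = x i.
  by rewrite /d valK prednK // (valP (x i)).
have [i lti|X ltX Xd] := @digits_surj n b d.
  by rewrite (dE (Ordinal lti)); apply: xb.
by exists X => //; apply: eq_posnat_ffun => i; rewrite decodeE /entry Xd.
Qed.

(** * Convergence *)

(** A system with two distinct solutions betrays itself once [k] bounds their
    entries; since there are finitely many systems over [n] variables, one
    threshold serves for all of them. It is obtained by a classical case
    distinction on each system, not by a computation, which is why [xi] is only
    reached in the limit. *)
Lemma uniqueness_stabilizes n : exists k0, forall k, k0 <= k ->
  forall (S : {set B n}) x, solution S x ->
    (forall y : {ffun 'I_n -> posnat}, (forall i, y i <= k) ->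
       solution S y -> x = y) ->
  unique (solution S) x.
Proof.
have bound S : exists k0, forall k, k0 <= k -> forall x, solution S x ->
    (forall y : {ffun 'I_n -> posnat}, (forall i, y i <= k) ->
       solution S y -> x = y) ->
    unique (solution S) x.
  have [[x [y [Sx Sy xy]]]|nS] :=
    pselect (exists x y, [/\ solution S x, solution S y & x <> y]).
    exists (\max_i maxn (x i) (y i)) => k lek z Sz zu.
    have {}lek i : (x i <= k) && (y i <= k).
      rewrite -geq_max; apply: leq_trans lek.
      exact: (leq_bigmax (F := fun i => maxn (x i) (y i))).
    case: xy; rewrite -(zu x) ?(zu y) // => i; by case/andP: (lek i).
  exists 0 => k _ x Sx _; split=> // y Sy.
  by apply: contrapT => xy; apply: nS; exists x, y.
have [f fP] := choice bound; exists (\max_S f S) => k lek S x.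
by apply: fP; apply: leq_trans lek; apply: leq_bigmax.
Qed.

(** Beyond the threshold, isolated tuples are genuine unique solutions, so their
    entries are at most [xi n]. Conversely, once [k >= xi n], every unique
    solution [x] of a system [S] has a code below [k ^ n] and is isolated,
    because the equations true at [x] include [S]. *)
Lemma approx_cvg (n : posnat) : exists k0, forall k, 0 < k -> k0 <= k ->
  approx n k = xi n.
Proof.
have [xi_bound xi_min] := xiP n.
have [k0 k0P] := uniqueness_stabilizes n.
exists (maxn k0 (xi n)) => k k_gt0; rewrite geq_max => /andP[k0k xik].
apply/eqP; rewrite eqn_leq; apply/andP; split.
  rewrite geq_max (valP (xi n)) /=; rewrite big_mkord; apply/bigmax_leqP => X _.
  case: ifP => // /isolatedP iX; rewrite big_mkord; apply/bigmax_leqP => i _.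
  rewrite -decodeE; apply: xi_bound (equations (decode n k X)) _ _ i.
  apply: (k0P k) => // [e|y yk Sy]; first by rewrite inE => /asboolP.
  by have [Y ltY YE] := code_surj yk; rewrite -YE; apply: iX => //; rewrite YE.
apply: xi_min => [|S x xu i]; first by rewrite leq_max.
have xk j : x j <= k by apply: leq_trans (xi_bound S x xu j) xik.
have [X ltX XE] := code_surj xk.
have iX : isolated n k X.
  apply/isolatedP => Y _ XY; rewrite XE in XY *; apply: xu.2 => e eS.
  by apply: XY; rewrite inE; apply/asboolP/xu.1.
rewrite leq_max; apply/orP; right; rewrite big_mkord.
apply: leq_trans (leq_bigmax (Ordinal ltX)); rewrite /= iX big_mkord -XE decodeE.
exact: (leq_bigmax (F := fun i : 'I_n => entry k X i)).
Qed.

Theorem theorem1 : computable_in_the_limit xi.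
Proof.
exists (fun n k => approx n k); split.
  by have [p pP] := recursive_approx; exists p => n k; apply: pP.
move=> n; have [k0 k0P] := approx_cvg n.
exists (exist _ k0.+1 (ltn0Sn k0)) => k lek.
by apply: k0P; [apply: (valP k) | apply: ltnW].
Qed.
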